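(* Let $M$ be a simply connected hyperkähler manifold, let $\mu_{A'_1\cdots A'_{2j}}$ be a valence $(0,2j)$ Killing tensor on $M$, and let $\mu_n$, $n\in\mathbb{Z}$, be its components in a parallel frame of $H$ chosen as specified in the context (so $\mu_n=0$ for $|n|>j$). Then the sequence $$\cdots,0,\ \mu_{-j},\ \dots,\ \mu_0,\ \dots,\ \mu_{+j},\ 0,\cdots$$ forms a (bounded) recursive chain of hyperpotentials with respect to the complex structure $I_0$.
   Context: $M$ is a hyperkähler manifold of real dimension $4m$, with hyperkähler metric $g$, complex structures $I_1,I_2,I_3$ with $I_1^2=I_2^2=I_3^2=I_1I_2I_3=-1$, and Kähler forms $\omega_k(X,Y)=g(X,I_kY)$. Endomorphisms of $TM$ act on 1-forms from the right, $(\alpha I)(X)=\alpha(IX)$. Put $I_+=\tfrac12(I_1+iI_2)$, $I_0=I_3$, $I_-=-\tfrac12(I_1-iI_2)$. The complexified tangent bundle splits as $T_{\mathbb{C}}M=E\otimes H$ with $E$, $H$ of ranks $2m$ and $2$, associated to the standard representations of $Sp(m)$ and $Sp(1)$. The Levi-Civita connection $\nabla$ preserves the splitting, and the connection induced on $H$ is flat; as $M$ is simply connected, $H$ is trivial and admits a global parallel frame. $E$-indices are $A,B,\dots$, $H$-indices are $A',B',\dots\in\{0',1'\}$. $E$ and $H$ carry parallel symplectic forms $\varepsilon_{AB},\varepsilon_{A'B'}$ used to raise and lower indices ($\xi_B=\xi^A\varepsilon_{AB}$, $\xi^A=\varepsilon^{AB}\xi_B$, likewise primed). One has $g_{AA',BB'}=\varepsilon_{AB}\varepsilon_{A'B'}$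 and $(I_k)^{AA'}{}_{BB'}=-i(\sigma_k)^{A'}{}_{B'}\delta^A{}_B$. Frame: a parallel frame of $H$ in which $\varepsilon_{0'1'}=1$ and $\sigma_k$ are the standard Pauli matrices $\sigma_1=\begin{pmatrix}0&1\\1&0\end{pmatrix}$, $\sigma_2=\begin{pmatrix}0&-i\\i&0\end{pmatrix}$, $\sigma_3=\begin{pmatrix}1&0\\0&-1\end{pmatrix}$; thus $I_{A'B'}:=\tfrac12(\sigma_k)_{A'B'}I_k$ has $I_{0'0'}=-I_+$, $I_{0'1'}=\tfrac12I_0$, $I_{1'1'}=-I_-$. A valence $(0,2j)$ Killing tensor ($j\ge1$ an integer) is a totally symmetric section $\mu_{A'_1\cdots A'_{2j}}$ of $S^{2j}H$ with $\nabla_{A(A'}\mu_{A'_1\cdots A'_{2j})}=0$ (round brackets: symmetrization). Its components are $\mu_n=(-1)^n\binom{2j}{j+n}\mu_{0'\cdots0'1'\cdots1'}$, with $j+n$ indices $0'$ and $j-n$ indices $1'$, for $-j\le n\le j$, and $\mu_n=0$ otherwise. A recursive chain of hyperpotentials with respect to $I_0$ is a sequence $(\phi_n)_{n\in\mathbb{Z}}$ of complex functions sharing a non-trivial common domain on which $d\phi_{n-1}I_++d\phi_nI_0+d\phi_{n+1}I_-=0$ for all $n$; equivalently $\bar\partial\phi_nI_+=-i\,\partial\phi_{n+1}$ for all $n$, with $\partial,\bar\partial$ the Dolbeault operators of $I_0$. *)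

(* Defs.v *)
From HB Require Import structures.
From mathcomp Require Import all_boot all_order all_algebra all_fingroup.
From mathcomp Require Import complex.
From mathcomp Require Import all_classical all_reals all_analysis.

Set Implicit Arguments.
Unset Strict Implicit.
Unset Printing Implicit Defensive.

Import Order.TTheory GRing.Theory Num.Theory.
Import numFieldNormedType.Exports.

Local Open Scope classical_set_scope.
Local Open Scope complex_scope.
Local Open Scope ring_scope.

(** * Smooth manifolds *)

(* Partial derivatives taken inductively: C^(k+1) = continuous, with all
   first partials existing on U and of class C^k there. Only used on open U. *)
Fixpoint class_Ck (R : realType) (d : nat) (U : set 'cV[R]_d) (k : nat)
    (f : 'cV[R]_d -> R) : Prop :=
  (forall x, U x -> {for x, continuous f}) /\
  (if k is k'.+1 then
     forall i : 'I_d,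
       (forall x, U x -> derivable f x (delta_mx i 0)) /\
       class_Ck U k' (fun x => 'D_(delta_mx i 0) f x)
   else True).

Definition class_Coo (R : realType) (d : nat) (U : set 'cV[R]_d)
    (f : 'cV[R]_d -> R) : Prop := forall k, class_Ck U k f.

(* The values of [cmap] off [cdom], and of [cinv] off [cmap @` cdom], are
   irrelevant. *)
Record chart (R : realType) (d : nat) (T : topologicalType) := Chart {
  cdom : set T;
  cmap : T -> 'cV[R]_d;
  cinv : 'cV[R]_d -> T;
  cdom_open : open cdom;
  cran_open : open (cmap @` cdom);
  cmapK : forall p, cdom p -> cinv (cmap p) = p;
  cmap_continuous : forall p, cdom p -> {for p, continuous cmap};
  cinv_continuous : forall x, (cmap @` cdom) x -> {for x, continuous cinv}
}.

(* The chosen chart [chart_at p] serves to identify T_pM with R^d. *)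
Record manifold (R : realType) (d : nat) := Manifold {
  mspace :> topologicalType;
  mspace_hausdorff : hausdorff_space mspace;
  mspace_second_countable : @second_countable mspace;
  atlas : set (chart R d mspace);
  chart_at : mspace -> chart R d mspace;
  chart_at_atlas : forall p, atlas (chart_at p);
  chart_at_dom : forall p, cdom (chart_at p) p;
  atlas_compat : forall c c', atlas c -> atlas c' -> forall i : 'I_d,
    class_Coo (cmap c @` (cdom c `&` cdom c'))
              (fun x => cmap c' (cinv c x) i 0)
}.

Definition simply_connected (R : realType) (T : topologicalType) : Prop :=
  [/\ exists x : T, True,
      forall x y : T, exists2 g : R -> T,
        {within `[0, 1], continuous g} & g 0 = x /\ g 1 = y
    & forall g : R -> T, {within `[0, 1], continuous g} -> g 0 = g 1 ->
        exists2 H : R * R -> T,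
          {within `[0, 1] `*` `[0, 1], continuous H}
        & forall t, t \in `[0, 1] ->
            [/\ H (0, t) = g t, H (1, t) = g 0, H (t, 0) = g 0
              & H (t, 1) = g 0]].

(** * Complex functions, tangent vectors and 1-forms *)

Definition smooth_on (R : realType) (d : nat) (M : manifold R d) (U : set M)
    (f : M -> R[i]) : Prop :=
  forall c, atlas c ->
    class_Coo (cmap c @` (cdom c `&` U)) (fun x => complex.Re (f (cinv c x))) /\
    class_Coo (cmap c @` (cdom c `&` U)) (fun x => complex.Im (f (cinv c x))).

(* T_pM is 'cV[R]_d and its complexification 'cV[R[i]]_d, in the coordinate
   basis of [chart_at p]; complex 1-forms at p are rows 'rV[R[i]]_d, so that
   alpha(X) is [alpha *m X] and endomorphisms act on 1-forms from the right. *)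
Definition dform (R : realType) (d : nat) (M : manifold R d)
    (f : M -> R[i]) (p : M) : 'rV[R[i]]_d :=
  let c := chart_at p in
  \row_i (('D_(delta_mx i 0) (fun x => complex.Re (f (cinv c x))) (cmap c p))
          +i* ('D_(delta_mx i 0) (fun x => complex.Im (f (cinv c x))) (cmap c p))).

(* Derivative of f at p along the complex tangent vector v. *)
Definition dirderiv (R : realType) (d : nat) (M : manifold R d)
    (f : M -> R[i]) (p : M) (v : 'cV[R[i]]_d) : R[i] :=
  (dform f p *m v) 0 0.

Definition toC (R : realType) (m n : nat) (A : 'M[R]_(m, n)) : 'M[R[i]]_(m, n) :=
  map_mx (fun x : R => x%:C) A.

Definition conjmx (R : realType) (m n : nat) (A : 'M[R[i]]_(m, n)) :
    'M[R[i]]_(m, n) :=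
  map_mx (fun x : R[i] => conjc x) A.

Definition bform (R : realType) (r : nat) (B : 'M[R[i]]_r)
    (x y : 'cV[R[i]]_r) : R[i] :=
  (x^T *m B *m y) 0 0.

(** * Complex vector bundles and connections *)

(* The fibre over every p is 'cV[C]_r in some fixed, not necessarily continuous,
   choice of basis; the smooth structure is carried by local trivializations,
   [tmx p] sending a fibre vector to its coordinates in the local frame. *)
Record triv (R : realType) (d : nat) (M : manifold R d) (r : nat) := Triv {
  tdom : set M;
  tmx : M -> 'M[R[i]]_r
}.

Definition bundle_atlas (R : realType) (d : nat) (M : manifold R d) (r : nat)
    (A : set (triv M r)) : Prop :=
  [/\ forall t, A t -> open (tdom t),
      forall t, A t -> forall p, tdom t p -> tmx t p \in unitmx,
      forall p : M, exists2 t, A t & tdom t p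
    & forall t t', A t -> A t' -> forall i j,
        smooth_on (tdom t `&` tdom t')
                  (fun p => (tmx t' p *m invmx (tmx t p)) i j)].

Definition smooth_section (R : realType) (d : nat) (M : manifold R d) (r : nat)
    (A : set (triv M r)) (U : set M) (s : M -> 'cV[R[i]]_r) : Prop :=
  forall t, A t -> forall i,
    smooth_on (tdom t `&` U) (fun p => (tmx t p *m s p) i 0).

(* The complexified tangent bundle: each chart c gives the trivialization whose
   rows are the differentials of the coordinate functions of c. *)
Definition tangent_atlas (R : realType) (d : nat) (M : manifold R d) :
    set (triv M d) :=
  [set t | exists2 c, atlas c &
     t = Triv (cdom c)
           (fun p => \matrix_(i, j) dform (fun q : M => (cmap c q i 0)%:C) p 0 j)].
Arguments tangent_atlas {R d} M _.

Definition smooth_field (R : realType) (d : nat) (M : manifold R d) (U : set M)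
    (X : M -> 'cV[R[i]]_d) : Prop :=
  smooth_section (tangent_atlas M) U X.

(* [nabla p v s] is the derivative of the local section s at p along the complex
   tangent vector v; it is constrained only where s is smooth near p. *)
Definition cov_deriv (R : realType) (d : nat) (M : manifold R d) (r : nat) :=
  forall p : M, 'cV[R[i]]_d -> (M -> 'cV[R[i]]_r) -> 'cV[R[i]]_r.

Record connection (R : realType) (d : nat) (M : manifold R d) (r : nat)
    (A : set (triv M r)) (nabla : cov_deriv M r) : Prop := Connection {
  conn_linear : forall U s, open U -> smooth_section A U s ->
    forall p, U p -> forall (a : R[i]) v w,
      nabla p (a *: v + w) s = a *: nabla p v s + nabla p w s;
  conn_add : forall U s t, open U -> smooth_section A U s ->
    smooth_section A U t -> forall p, U p -> forall v,
      nabla p v (fun q => s q + t q) = nabla p v s + nabla p v t;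
  conn_leibniz : forall U f s, open U -> smooth_on U f ->
    smooth_section A U s -> forall p, U p -> forall v,
      nabla p v (fun q => f q *: s q) = dirderiv f p v *: s p + f p *: nabla p v s;
  conn_local : forall U s t, open U -> smooth_section A U s ->
    (forall q, U q -> s q = t q) -> forall p, U p -> forall v,
      nabla p v s = nabla p v t;
  conn_smooth : forall U X s, open U -> smooth_field U X ->
    smooth_section A U s -> smooth_section A U (fun p => nabla p (X p) s)
}.

(** * Hyperkaehler manifolds *)

Inductive axis := K1 | K2 | K3.

(* The Levi-Civita connection, extended complex-linearly to complex vector
   fields, g being extended complex-bilinearly. *)
Record levi_civita (R : realType) (d : nat) (M : manifold R d)
    (g : M -> 'M[R]_d) (nabla : cov_deriv M d) : Prop := LeviCivita {
  lc_connection : connection (tangent_atlas M) nabla;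
  lc_metric : forall U X Y, open U -> smooth_field U X -> smooth_field U Y ->
    forall p, U p -> forall v,
      dirderiv (fun q => bform (toC (g q)) (X q) (Y q)) p v =
      bform (toC (g p)) (nabla p v X) (Y p) +
      bform (toC (g p)) (X p) (nabla p v Y);
  lc_torsion_free : forall U X Y f, open U -> smooth_field U X ->
    smooth_field U Y -> smooth_on U f -> forall p, U p ->
      dirderiv f p (nabla p (X p) Y - nabla p (Y p) X) =
      dirderiv (fun q => dirderiv f q (Y q)) p (X p) -
      dirderiv (fun q => dirderiv f q (X q)) p (Y p)
}.

Record hyperkahler (R : realType) (d : nat) (M : manifold R d) := Hyperkahler {
  hk_g : M -> 'M[R]_d;
  hk_I : axis -> M -> 'M[R]_d;
  hk_nabla : cov_deriv M d;
  hk_g_smooth : forall U X Y, open U -> smooth_field U X -> smooth_field U Y ->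
    smooth_on U (fun p => bform (toC (hk_g p)) (X p) (Y p));
  hk_g_sym : forall p, (hk_g p)^T = hk_g p;
  hk_g_pos : forall p (x : 'cV[R]_d), x != 0 -> 0 < (x^T *m hk_g p *m x) 0 0;
  hk_levi_civita : levi_civita hk_g hk_nabla;
  hk_I_smooth : forall k U X, open U -> smooth_field U X ->
    smooth_field U (fun p => toC (hk_I k p) *m X p);
  hk_I_sqr : forall k p, hk_I k p *m hk_I k p = - 1%:M;
  hk_I_123 : forall p, hk_I K1 p *m hk_I K2 p *m hk_I K3 p = - 1%:M;
  hk_I_orthogonal : forall k p, (hk_I k p)^T *m hk_g p *m hk_I k p = hk_g p;
  hk_I_parallel : forall k U X, open U -> smooth_field U X ->
    forall p, U p -> forall v,
      hk_nabla p v (fun q => toC (hk_I k q) *m X q) =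
      toC (hk_I k p) *m hk_nabla p v X
}.

Section RecursiveChains.
Context (R : realType) (d : nat) (M : manifold R d) (hk : hyperkahler M).

Definition Iplus (p : M) : 'M[R[i]]_d :=
  2^-1 *: (toC (hk_I hk K1 p) + 'i%C *: toC (hk_I hk K2 p)).
Definition Izero (p : M) : 'M[R[i]]_d := toC (hk_I hk K3 p).
Definition Iminus (p : M) : 'M[R[i]]_d :=
  - (2^-1 *: (toC (hk_I hk K1 p) - 'i%C *: toC (hk_I hk K2 p))).

Definition recursive_chain (U : set M) (phi : int -> M -> R[i]) : Prop :=
  [/\ open U, U !=set0, forall n, smooth_on U (phi n)
    & forall n p, U p ->
        dform (phi (n - 1)) p *m Iplus p + dform (phi n) p *m Izero p
        + dform (phi (n + 1)) p *m Iminus p = 0].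

Definition bounded_chain (phi : int -> M -> R[i]) : Prop :=
  exists N : int, forall n, N < `|n| -> forall p, phi n p = 0.

End RecursiveChains.

(** * The splitting of the complexified tangent bundle *)

(* A complex vector bundle associated to the standard representation on C^r of
   the compact group Sp(r/2), with a connection induced from the principal
   Sp(r/2)-bundle: the invariants of that representation are the symplectic form
   [sp_eps] and the quaternionic structure x |-> [sp_J *m conjmx x], for which
   [sp_eps (x, J x)] is a Hermitian norm; all are parallel. *)
Record sp_bundle (R : realType) (d : nat) (M : manifold R d) (r : nat) := SpBundle {
  sp_atlas : set (triv M r);
  sp_eps : M -> 'M[R[i]]_r;
  sp_J : M -> 'M[R[i]]_r;
  sp_nabla : cov_deriv M r;
  sp_bundle_atlas : bundle_atlas sp_atlas;
  sp_connection : connection sp_atlas sp_nabla;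
  sp_eps_smooth : forall U s t, open U -> smooth_section sp_atlas U s ->
    smooth_section sp_atlas U t ->
    smooth_on U (fun p => bform (sp_eps p) (s p) (t p));
  sp_eps_skew : forall p, (sp_eps p)^T = - sp_eps p;
  sp_eps_unit : forall p, sp_eps p \in unitmx;
  sp_eps_parallel : forall U s t, open U -> smooth_section sp_atlas U s ->
    smooth_section sp_atlas U t -> forall p, U p -> forall v,
      dirderiv (fun q => bform (sp_eps q) (s q) (t q)) p v =
      bform (sp_eps p) (sp_nabla p v s) (t p) +
      bform (sp_eps p) (s p) (sp_nabla p v t);
  sp_J_smooth : forall U s, open U -> smooth_section sp_atlas U s ->
    smooth_section sp_atlas U (fun p => sp_J p *m conjmx (s p));
  sp_J_sqr : forall p, sp_J p *m conjmx (sp_J p) = - 1%:M;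
  sp_J_eps : forall p x y,
    bform (sp_eps p) (sp_J p *m conjmx x) (sp_J p *m conjmx y) =
    conjc (bform (sp_eps p) x y);
  sp_J_pos : forall p x, x != 0 ->
    0 < bform (sp_eps p) x (sp_J p *m conjmx x);
  sp_J_parallel : forall U s, open U -> smooth_section sp_atlas U s ->
    forall p, U p -> forall v,
      sp_nabla p v (fun q => sp_J q *m conjmx (s q)) =
      sp_J p *m conjmx (sp_nabla p (conjmx v) s)
}.

(* The array (X^{AA'}) of components of a (x) h. *)
Definition tens (R : realType) (r s : nat) (a : 'cV[R[i]]_r) (h : 'cV[R[i]]_s) :
    'M[R[i]]_(r, s) := a *m h^T.

(* T_C M = E (x) H as bundles with connection, metric, real structure and
   quaternionic action. [spl_sigma k p], an endomorphism of H_p, is the sigma_k in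
   (I_k)^{AA'}_{BB'} = -i (sigma_k)^{A'}_{B'} delta^A_B. *)
Record EH_splitting (R : realType) (m : nat) (M : manifold R (4 * m))
    (hk : hyperkahler M) := EHSplitting {
  spl_E : sp_bundle M (2 * m);
  spl_H : sp_bundle M 2;
  spl_iso : forall p : M, {linear 'M[R[i]]_(2 * m, 2) -> 'cV[R[i]]_(4 * m)};
  spl_sigma : axis -> M -> 'M[R[i]]_2;
  spl_iso_bij : forall p, bijective (spl_iso p);
  spl_iso_smooth : forall U a h, open U ->
    smooth_section (sp_atlas spl_E) U a -> smooth_section (sp_atlas spl_H) U h ->
    smooth_field U (fun p => spl_iso p (tens (a p) (h p)));
  spl_iso_real : forall p a h,
    conjmx (spl_iso p (tens a h)) =
    spl_iso p (tens (sp_J spl_E p *m conjmx a) (sp_J spl_H p *m conjmx h));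
  spl_iso_parallel : forall U a h, open U ->
    smooth_section (sp_atlas spl_E) U a -> smooth_section (sp_atlas spl_H) U h ->
    forall p, U p -> forall v,
      hk_nabla hk p v (fun q => spl_iso q (tens (a q) (h q))) =
      spl_iso p (tens (sp_nabla spl_E p v a) (h p)) +
      spl_iso p (tens (a p) (sp_nabla spl_H p v h));
  spl_g : forall p a b h k,
    bform (toC (hk_g hk p)) (spl_iso p (tens a h)) (spl_iso p (tens b k)) =
    bform (sp_eps spl_E p) a b * bform (sp_eps spl_H p) h k;
  spl_I : forall k p a h,
    toC (hk_I hk k p) *m spl_iso p (tens a h) =
    spl_iso p (tens a (- 'i%C *: (spl_sigma k p *m h)))
}.

(** * Parallel frames of H and Killing tensors *)

(* Entry (A', B') is (sigma_k)^{A'}_{B'}; the indices 0', 1' are 0, 1 : 'I_2. *)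
Definition pauli (R : realType) (k : axis) (A' B' : 'I_2) : R[i] :=
  match k with
  | K1 => if A' == B' then 0 else 1
  | K2 => if A' == B' then 0 else if A' == 0 then - 'i%C else 'i%C
  | K3 => if A' != B' then 0 else if A' == 0 then 1 else - 1
  end.

Section KillingTensors.
Context (R : realType) (m : nat) (M : manifold R (4 * m)) (hk : hyperkahler M).
Context (spl : EH_splitting hk).

Local Notation H := (spl_H spl).

(* That [h] is a basis of each fibre follows from [eps(h_0, h_1) = 1]. *)
Definition adapted_parallel_frame (h : 'I_2 -> M -> 'cV[R[i]]_2) : Prop :=
  [/\ forall B', smooth_section (sp_atlas H) setT (h B'),
      forall B' p v, sp_nabla H p v (h B') = 0,
      forall p, bform (sp_eps H p) (h 0 p) (h 1 p) = 1
    & forall k B' p,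
        spl_sigma spl k p *m h B' p = \sum_(A' < 2) pauli R k A' B' *: h A' p].

(* Tensors mu_{A'_1 ... A'_n} with n lower indices are n-linear forms on the
   fibres of H, mu_{A'_1 ... A'_n} being the value on (h_{A'_1}, ..., h_{A'_n});
   parallel identification of H with its dual by eps makes them sections of the
   n-th tensor power of H. *)
Definition Htensor (n : nat) := forall p : M, ('I_n -> 'cV[R[i]]_2) -> R[i].

(* The induced covariant derivative, evaluated on local sections s_1, ..., s_n. *)
Definition Htensor_nabla (n : nat) (mu : Htensor n) (p : M)
    (v : 'cV[R[i]]_(4 * m)) (s : 'I_n -> M -> 'cV[R[i]]_2) : R[i] :=
  dirderiv (fun q => mu q (fun k => s k q)) p v
  - \sum_(i < n) mu p [eta (fun k => s k p) with i |-> sp_nabla H p v (s i)].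

(* In [kt_eq], contracting nabla_{A(A'} mu_{A'_1 ... A'_n)} with a in E and with
   s_0, ..., s_n in H symmetrizes over the permutations of s_0, ..., s_n. *)
Record killing_tensor (n : nat) (mu : Htensor n) : Prop := KillingTensor {
  kt_multilinear : forall p (s : 'I_n -> 'cV[R[i]]_2) i (a : R[i]) x y,
    mu p [eta s with i |-> a *: x + y] =
    a * mu p [eta s with i |-> x] + mu p [eta s with i |-> y];
  kt_symmetric : forall p (s : 'I_n -> 'cV[R[i]]_2) (pi : 'S_n),
    mu p (fun k => s (pi k)) = mu p s;
  kt_smooth : forall U (s : 'I_n -> M -> 'cV[R[i]]_2), open U ->
    (forall k, smooth_section (sp_atlas H) U (s k)) ->
    smooth_on U (fun p => mu p (fun k => s k p));
  kt_eq : forall U (s : 'I_n.+1 -> M -> 'cV[R[i]]_2), open U ->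
    (forall k, smooth_section (sp_atlas H) U (s k)) ->
    forall p, U p -> forall a : 'cV[R[i]]_(2 * m),
      (n.+1)`!%:R^-1 *
      \sum_(pi : 'S_n.+1)
        Htensor_nabla mu p (spl_iso spl p (tens a (s (pi ord0) p)))
                      (fun k => s (pi (lift ord0 k))) = 0
}.

Definition killing_component (j : nat) (mu : Htensor (2 * j))
    (h : 'I_2 -> M -> 'cV[R[i]]_2) (n : int) (p : M) : R[i] :=
  if `|n| <= j%:Z then
    let zeros := `|(j%:Z + n)%R|%N in
    (-1 : R[i]) ^ n * 'C(2 * j, zeros)%:R
    * mu p (fun k => if (k < zeros)%N then h 0 p else h 1 p)
  else 0.

End KillingTensors.

(* Main.v *)
Require Import Defs.
From mathcomp Require Import all_boot all_order all_algebra all_fingroup.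
From mathcomp Require Import complex ring zify.
From mathcomp Require Import all_classical all_reals all_analysis.

(** Write mu_z for the component of the Killing tensor mu with z indices 0' and
    2j - z indices 1', and D_B f = df(a (x) h_B) for the derivative of f along
    a (x) h_B, where a is a fixed vector of E and h_0, h_1 the parallel frame
    of H.

    On span(a (x) h_0, a (x) h_1) the operators I_+, I_0, I_- act through the
    Pauli matrices as -i times the raising, diagonal and (up to sign) lowering
    operators ([ladder_frame]).
    Evaluating the recursion at level n on a (x) h_0 and on a (x) h_1 therefore
    turns it into the two scalar equations
      D_0 phi_n = D_1 phi_(n+1)   and   D_0 phi_(n-1) = D_1 phi_n,
    and these test the whole 1-form, since the vectors a (x) h_B span the
    complexified tangent space ([chain_frame]). The recursion for all n is thus
    the single family D_0 phi_n = D_1 phi_(n+1).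

    Contract the Killing equation with Z copies of h_0 and 2j + 1 - Z copies of
    h_1. The frame is parallel, so the covariant derivative of mu is the
    ordinary derivative of its components; by symmetry each permutation
    contributes D_0 mu_(Z-1) or D_1 mu_Z according to the frame vector it puts
    in the differentiating slot. As every argument occupies that slot equally
    often ([sum_perm_ord0]), one gets
      Z D_0 mu_(Z-1) + (2j + 1 - Z) D_1 mu_Z = 0
    ([killing_frame_relation]). The signs and binomial coefficients in phi_n are
    exactly what turns this into D_0 phi_n = D_1 phi_(n+1), because
    Z C(2j, Z) = (2j + 1 - Z) C(2j, Z - 1); at Z = 0 and Z = 2j + 1 only one
    term is left, which gives the equations at the two ends of the chain
    ([killing_component_step]). *)

Set Implicit Arguments.
Unset Strict Implicit.
Unset Printing Implicit Defensive.

Import Order.TTheory GRing.Theory Num.Theory.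
Import numFieldNormedType.Exports.

Local Open Scope classical_set_scope.
Local Open Scope ring_scope.

(** * Complex multiples of smooth functions *)

(** The identity between u, f and g is assumed on the open set U only, because
    the induction applies to the partial derivatives, for which linearity is
    available only at points of U. *)
Lemma class_Ck_lincomb (R : realType) (d : nat) (U : set 'cV[R]_d) (k : nat)
    (a b : R) (f g u : 'cV[R]_d -> R) :
  open U -> class_Ck U k f -> class_Ck U k g ->
  (forall x, U x -> u x = a * f x + b * g x) -> class_Ck U k u.
Proof.
move=> Uop; elim: k f g u => [|k IHk] f g u /= [f0 f1] [g0 g1] uE.
all: have near_u x : U x -> \near x, a * f x + b * g x = u x
  by move=> Ux; apply: filterS (open_nbhs_nbhs (conj Uop Ux)) => y /uE.
all: split; first by move=> x Ux;
  apply: cvg_trans (near_eq_cvg (near_u x Ux)) _; rewrite uE //;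
  apply: cvgD; apply: cvgMr; [exact: f0 | exact: g0].
  by [].
move=> i; have [[df f2] [dg g2]] := (f1 i, g1 i).
have dZ c (v : 'cV[R]_d -> R) x : derivable v x (delta_mx i 0) ->
    derivable (c \*: v) x (delta_mx i 0) by exact: derivableZ.
split=> [x Ux|].
  apply: (near_eq_derivable (near_u x Ux)).
  by apply: derivableD; apply: dZ; [exact: df | exact: dg].
apply: (IHk _ _ _ f2 g2) => x Ux.
rewrite -(near_eq_derive _ (near_u x Ux)).
rewrite (@deriveD _ _ _ (a \*: f) (b \*: g)); last 2 first.
- exact/dZ/df.
- exact/dZ/dg.
by rewrite !deriveZ; [|exact: dg|exact: df].
Qed.

(** By continuity, the inverse chart maps a neighbourhood of the image of a point
    of U into U. *)
Lemma open_chart_image (R : realType) (d : nat) (T : topologicalType)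
    (c : chart R d T) (U : set T) : open U -> open (cmap c @` (cdom c `&` U)).
Proof.
rewrite !openE => Uop _ [p [cp Up] <-].
have cran : (cmap c @` cdom c) (cmap c p) by exists p.
have Uinv : nbhs (cmap c p) (cinv c @^-1` U).
  by apply: (cinv_continuous cran); rewrite /= cmapK //; exact: Uop.
have : nbhs (cmap c p) (cmap c @` cdom c).
  by apply: open_nbhs_nbhs; split; first exact: cran_open.
rewrite /interior; move: Uinv; apply: filterS2 => _ /[swap] -[q cq <-] /=.
by rewrite cmapK // => Uq; exists q.
Qed.

Lemma smooth_on_scale (R : realType) (d : nat) (M : manifold R d) (U : set M)
    (z : R[i]) (f : M -> R[i]) :
  open U -> smooth_on U f -> smooth_on U (fun p => z * f p).
Proof.
case: z => a b Uop fU c cA; have [fRe fIm] := fU c cA.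
have Wop := open_chart_image (c := c) Uop.
split=> k; [apply: (class_Ck_lincomb (a := a) (b := - b) Wop (fRe k) (fIm k))
          | apply: (class_Ck_lincomb (a := b) (b := a) Wop (fRe k) (fIm k))].
  by move=> x _; case: (f _) => u v /=; ring.
by move=> x _; case: (f _) => u v /=; ring.
Qed.

Lemma dform_scale (R : realType) (d : nat) (M : manifold R d) (U : set M)
    (z : R[i]) (f : M -> R[i]) (p : M) :
  open U -> smooth_on U f -> U p ->
  dform (fun q => z * f q) p = z *: dform f p.
Proof.
move=> Uop fU Up; have [fRe fIm] := fU _ (chart_at_atlas p).
have pU : (cmap (chart_at p) @` (cdom (chart_at p) `&` U)) (cmap (chart_at p) p).
  by exists p => //; split=> //; exact: chart_at_dom.
apply/rowP => i; rewrite !mxE.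
have [/(_ _ pU) dRe _] := (fRe 1%N).2 i; have [/(_ _ pU) dIm _] := (fIm 1%N).2 i.
set c := chart_at p; have lin (u : 'cV[R]_d -> R) a b :
    (forall x, u x = a * complex.Re (f (cinv c x)) + b * complex.Im (f (cinv c x))) ->
    'D_(delta_mx i 0) u (cmap c p) =
    a * 'D_(delta_mx i 0) (fun x => complex.Re (f (cinv c x))) (cmap c p) +
    b * 'D_(delta_mx i 0) (fun x => complex.Im (f (cinv c x))) (cmap c p).
  move/funext->; rewrite (@deriveD _ _ _ (a \*: fun x => complex.Re (f (cinv c x)))
     (b \*: fun x => complex.Im (f (cinv c x)))); last 2 first.
  - exact: derivableZ.
  - exact: derivableZ.
  by rewrite !deriveZ.
case: z => a b; apply/eqP; rewrite eq_complex /= -mulNr.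
by apply/andP; split; apply/eqP; [apply: lin | rewrite addrC; apply: lin] => x;
   case: (f _) => u v /=; ring.
Qed.

(** * Permutations and words in two letters *)

Lemma perm_eq_weight (n : nat) (b c : 'I_n -> bool) :
  (\sum_i b i = \sum_i c i)%N -> exists s : 'S_n, forall i, b i = c (s i).
Proof.
move=> bc.
have count_true (e : 'I_n -> bool) :
    count id [tuple e i | i < n] = (\sum_i e i)%N.
  by rewrite /= count_map -sumn_count sumnE big_map big_enum.
have : perm_eq [tuple b i | i < n] [tuple c i | i < n].
  apply/allP => x _ /=; apply/eqP.
  have eqt (e : 'I_n -> bool) : count_mem true [tuple e i | i < n] = (\sum_i e i)%N.
    by rewrite -count_true; apply: eq_count; case.
  have eqf (e : 'I_n -> bool) : count_mem false [tuple e i | i < n] = (n - \sum_i e i)%N.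
    rewrite -count_true -[X in (X - _)%N](size_tuple [tuple e i | i < n]).
    rewrite -(count_predC id) addKn.
    by apply: eq_count; case.
  by case: x; rewrite ?eqt ?eqf bc.
case/tuple_permP => s /val_inj bcs; exists s => i.
by rewrite -(tnth_mktuple b) bcs !tnth_mktuple.
Qed.

(** Composition with the transposition of 0 and x is a bijection from the
    permutations fixing 0 to those sending 0 to x, so every value is taken
    equally often. *)
Lemma sum_perm_ord0 (V : zmodType) (n : nat) (F : 'I_n.+1 -> V) :
  \sum_(s : 'S_n.+1) F (s ord0) =
  (\sum_x F x) *+ #|[pred s : 'S_n.+1 | s ord0 == ord0]|.
Proof.
rewrite (partition_big (fun s : 'S_n.+1 => s ord0) xpredT) //= -sumrMnl.
apply: eq_bigr => x _.
rewrite (reindex_inj (mulIg (tperm ord0 x))) /= -sumr_const.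
apply: eq_big => [s|s /eqP-> //].
by rewrite !inE permM -[X in _ == X](tpermL ord0 x) (inj_eq perm_inj).
Qed.

Lemma sum_lt (n Z : nat) : (Z <= n)%N -> (\sum_(i < n) (i < Z) = Z)%N.
Proof.
move=> Zn; rewrite -(big_mkord xpredT (fun i => (i < Z)%N : nat)).
rewrite (big_cat_nat (leq0n Z) Zn) //= [X in (X + _)%N]big_nat [X in (_ + X)%N]big_nat.
rewrite (eq_bigr (fun=> 1%N)) => [|i /andP[_ ->] //].
rewrite -big_nat sum_nat_const_nat subn0 muln1 big1 ?addn0 // => i /andP[Zi _].
by rewrite ltnNge Zi.
Qed.

Lemma sum_lt_perm (n Z : nat) (s : 'S_n.+1) : (Z <= n.+1)%N ->
  ((s ord0 < Z) + \sum_(k < n) (s (lift ord0 k) < Z) = Z)%N.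
Proof.
move=> Zn; rewrite -(big_ord_recl n (fun i => (s i < Z)%N : nat)) -[RHS](sum_lt Zn).
by rewrite [RHS](reindex_inj (@perm_inj _ s)).
Qed.

(** * Symplectic frames *)

Lemma ord2P (B : 'I_2) : B = 0 \/ B = 1.
Proof. by case: B => -[|[|//]] ?; [left|right]; apply: val_inj. Qed.

(** Skewness forces the Gram matrix G of the frame to be ((0, 1), (-1, 0)), so
    that G^2 = -1; a frame with an invertible Gram matrix is a basis. *)
Lemma symplectic_frame_spans (K : fieldType) (r : nat) (S : 'M[K]_2)
    (w : 'I_2 -> 'cV[K]_2) :
  2%:R != 0 :> K -> S^T = - S -> ((w 0)^T *m S *m w 1) 0 0 = 1 ->
  forall Y : 'M[K]_(r, 2), exists a : 'I_2 -> 'cV[K]_r,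
    Y = \sum_(B < 2) a B *m (w B)^T.
Proof.
move=> K2 Sskew w01 Y.
pose W := \matrix_(B, i) w B i 0; pose G := W *m S *m W^T.
have rowW B : row B W = (w B)^T by apply/rowP => i; rewrite !mxE.
have GE B C : G B C = ((w B)^T *m S *m w C) 0 0.
  rewrite -rowW -row_mul [in LHS]mxE [in RHS]mxE.
  by apply: eq_bigr => k _; rewrite [in RHS]mxE [W^T _ _]mxE [W _ _]mxE.
have Gskew B C : G B C = - G C B.
  suff /matrixP/(_ C B) : G^T = - G by rewrite [LHS]mxE [RHS]mxE.
  by rewrite /G !trmx_mul trmxK Sskew mulNmx mulmxN mulmxA.
have G0 B : G B B = 0.
  apply/eqP; have /eqP := Gskew B B; rewrite -addr_eq0 -mulr2n -mulr_natl.
  by rewrite mulf_eq0 (negPf K2).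
have G01 : G 0 1 = 1 by rewrite GE.
have G10 : G 1 0 = - 1 by rewrite Gskew G01.
(* As G = W S W^T, this makes - S W^T G an inverse of W. *)
have GG : G *m G = - 1%:M.
  apply/matrixP => B C; rewrite [LHS]mxE [RHS]mxE [1%:M _ _]mxE !big_ord_recl big_ord0.
  have -> : lift ord0 ord0 = 1 :> 'I_2 by apply: val_inj.
  rewrite addr0; case: (ord2P B) => ->; case: (ord2P C) => ->;
    rewrite ?G0 ?G01 ?G10 /=; ring.
have WV : W *m (- (S *m W^T *m G)) = 1%:M.
  by rewrite mulmxN mulmxA [W *m (S *m _)]mulmxA GG opprK.
exists (fun B => col B (Y *m (- (S *m W^T *m G)))).
rewrite -[LHS]mulmx1 -(mulmx1C WV) mulmxA.
apply/matrixP => i k; rewrite summxE mxE; apply: eq_bigr => B _.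
by rewrite -rowW !mxE big_ord1 !mxE.
Qed.

(** * The Killing equation in a parallel frame *)

Section Killing.
Context (R : realType) (m : nat) (M : manifold R (4 * m)) (hk : hyperkahler M).
Context (spl : EH_splitting hk) (h : 'I_2 -> M -> 'cV[R[i]]_2).
Context (h_frame : adapted_parallel_frame spl h).

Definition word_component (n : nat) (mu : Htensor M n) (z : nat) (q : M) : R[i] :=
  mu q (fun k => if (k < z)%N then h 0 q else h 1 q).

Definition frame_deriv (f : M -> R[i]) (p : M) (a : 'cV[R[i]]_(2 * m))
    (B : 'I_2) : R[i] := dirderiv f p (spl_iso spl p (tens a (h B p))).

Section OneTensor.
Context (n : nat) (mu : Htensor M n) (mu_killing : killing_tensor spl mu).

Lemma killing_form0 p (s : 'I_n -> 'cV[R[i]]_2) i : mu p [eta s with i |-> 0] = 0.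
Proof.
have := kt_multilinear mu_killing p s i 1 0 0.
rewrite scaler0 addr0 mul1r => /eqP.
by rewrite eq_sym -subr_eq0 addrK => /eqP.
Qed.

(** By symmetry of mu, only the numbers of h_0 and of h_1 among its arguments
    matter. *)
Lemma killing_form_weight p (x : 'I_2 -> 'cV[R[i]]_2) (b c : 'I_n -> bool) :
  (\sum_i b i = \sum_i c i)%N ->
  mu p (fun k => if b k then x 0 else x 1) = mu p (fun k => if c k then x 0 else x 1).
Proof.
move=> /perm_eq_weight[s bc].
rewrite -(kt_symmetric mu_killing p (fun k => if c k then x 0 else x 1) s).
by congr (mu p _); apply/funext => k; rewrite bc.
Qed.

(** All correction terms contain a covariant derivative of a parallel section,
    and a multilinear form vanishes when one of its arguments does. *)
Lemma Htensor_nabla_frame p v (B : 'I_n -> 'I_2) :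
  Htensor_nabla spl mu p v (fun k => h (B k)) =
  dirderiv (fun q => mu q (fun k => h (B k) q)) p v.
Proof.
have [_ h_par _ _] := h_frame.
rewrite /Htensor_nabla big1 ?subr0 // => i _.
by rewrite h_par killing_form0.
Qed.

Lemma word_component_smooth z : smooth_on setT (word_component mu z).
Proof.
have [h_smooth _ _ _] := h_frame.
pose s (k : 'I_n) := h (if (k < z)%N then 0 else 1).
have -> : word_component mu z = fun p => mu p (fun k => s k p).
  apply/funext => p; congr (mu p _); apply/funext => k.
  by rewrite /s; case: ifP.
by apply: (kt_smooth mu_killing openT) => k; apply: h_smooth.
Qed.

(** The Killing equation contracted with Z copies of h_0 and n + 1 - Z copies
    of h_1. When Z = 0, the truncated index Z.-1 comes with the coefficient 0. *)
Lemma killing_frame_relation (Z : nat) p a : (Z <= n.+1)%N ->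
  Z%:R * frame_deriv (word_component mu Z.-1) p a 0
  + (n.+1 - Z)%:R * frame_deriv (word_component mu Z) p a 1 = 0.
Proof.
move=> Zn; have [h_smooth _ _ _] := h_frame.
pose B (k : nat) : 'I_2 := if (k < Z)%N then 0 else 1.
have := kt_eq mu_killing openT (fun k : 'I_n.+1 => h_smooth (B k)) (I : setT p) a.
(* F x is the contribution of a permutation placing the x-th argument in the
   differentiating slot; the remaining arguments contain Z - (x < Z) copies
   of h_0. *)
pose F (x : 'I_n.+1) := frame_deriv (word_component mu (Z - (x < Z))) p a (B x).
rewrite (eq_bigr (fun pi : 'S_n.+1 => F (pi ord0))) => [|pi _]; last first.
  apply: etrans (Htensor_nabla_frame _ _ (fun k => B (pi (lift ord0 k)))) _.
  rewrite /F /frame_deriv; congr (dirderiv _ p _).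
  apply/funext => q; rewrite /word_component.
  have sZ := sum_lt_perm pi Zn.
  transitivity (mu q (fun k => if (pi (lift ord0 k) < Z)%N then h 0 q else h 1 q)).
    by congr (mu q _); apply/funext => k; rewrite /B; case: ifP.
  apply: (killing_form_weight q (fun B => h B q)).
  have := ltn_ord (pi ord0); case: (ltnP (pi ord0) Z) sZ => /= ? ? ?;
    rewrite sum_lt; lia.
rewrite sum_perm_ord0 => /eqP.
rewrite mulf_eq0 invr_eq0 pnatr_eq0 gtn_eqF ?fact_gt0 //= mulrn_eq0.
have /negPf-> /= : #|[pred s : 'S_n.+1 | s ord0 == ord0]| != 0%N.
  by rewrite -lt0n; apply/card_gt0P; exists 1%g; rewrite inE perm1.
move=> /eqP <-.
rewrite -(big_mkord xpredT (fun x => frame_deriv (word_component mu (Z - (x < Z)%N)) p a (B x))).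
rewrite (big_cat_nat (leq0n Z) Zn) /=; congr (_ + _).
  rewrite big_nat (eq_bigr (fun=> frame_deriv (word_component mu Z.-1) p a 0)).
    by rewrite -big_nat sumr_const_nat subn0 mulr_natl.
  by move=> i /andP[_ iZ]; rewrite /B iZ subn1.
rewrite big_nat (eq_bigr (fun=> frame_deriv (word_component mu Z) p a 1)).
  by rewrite -big_nat sumr_const_nat mulr_natl.
by move=> i /andP[Zi _]; rewrite /B ltnNge Zi subn0.
Qed.
End OneTensor.

(** * The recursion in a parallel frame *)

Lemma hk_I_frame k p a B :
  toC (hk_I hk k p) *m spl_iso spl p (tens a (h B p)) =
  - 'i%C *: \sum_(A < 2) pauli R k A B *: spl_iso spl p (tens a (h A p)).
Proof.
have [_ _ _ h_sigma] := h_frame.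
rewrite spl_I h_sigma /tens linearZ /= -scalemxAr linearZ /=; congr (_ *: _).
rewrite linear_sum mulmx_sumr linear_sum; apply: eq_bigr => A _.
by rewrite linearZ /= -scalemxAr linearZ.
Qed.

Lemma frame_tensors_span p (X : 'cV[R[i]]_(4 * m)) :
  exists a, X = \sum_(B < 2) spl_iso spl p (tens (a B) (h B p)).
Proof.
have [_ _ h_eps _] := h_frame.
have [iso' _ isoK] := spl_iso_bij spl p.
have R2 : 2%:R != 0 :> R[i] by rewrite pnatr_eq0.
have [a aE] := symplectic_frame_spans (w := fun B => h B p) R2
                 (sp_eps_skew (spl_H spl) p) (h_eps p) (iso' X).
by exists a; rewrite -[X in X = _]isoK aE linear_sum.
Qed.

Lemma ladder_frame p a (X := fun B => spl_iso spl p (tens a (h B p))) :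
  [/\ Iplus hk p *m X 0 = 0, Iplus hk p *m X 1 = - 'i%C *: X 0,
      Izero hk p *m X 0 = - 'i%C *: X 0, Izero hk p *m X 1 = 'i%C *: X 1
    & Iminus hk p *m X 0 = 'i%C *: X 1 /\ Iminus hk p *m X 1 = 0].
Proof.
have I_X k B : toC (hk_I hk k p) *m X B =
    - 'i%C *: (pauli R k 0 B *: X 0 + pauli R k 1 B *: X 1).
  rewrite hk_I_frame !big_ord_recl big_ord0 addr0.
  by have -> : lift ord0 ord0 = 1 :> 'I_2 by apply: val_inj.
have ii (Y : 'cV[R[i]]_(4 * m)) : 'i%C *: (- 'i%C *: Y) = Y.
  by rewrite scalerA mulrN -expr2 sqr_i opprK scale1r.
split; [| | | | split]; rewrite /Iplus /Izero /Iminus ?mulNmx -?scalemxAl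
  ?mulmxDl ?mulNmx -?scalemxAl !I_X ?ii.
all: by apply/colP => t; rewrite /pauli /= !mxE; field.
Qed.

(** The recursion for the triple (f, g, u) evaluated on a (x) h_0 involves g
    and u only, since I_+ kills it; on a (x) h_1 it involves f and g only, since
    I_- kills it. *)
Lemma chain_frame (f g u : M -> R[i]) p :
  (forall a, frame_deriv f p a 0 = frame_deriv g p a 1) ->
  (forall a, frame_deriv g p a 0 = frame_deriv u p a 1) ->
  dform f p *m Iplus hk p + dform g p *m Izero hk p + dform u p *m Iminus hk p = 0.
Proof.
move=> fg gu; set alpha := (X in X = 0).
suff alpha_frame a B : (alpha *m spl_iso spl p (tens a (h B p))) 0 0 = 0.
  apply/rowP => i; have [a aE] := frame_tensors_span p (delta_mx i 0).
  have <- : col i alpha 0 0 = alpha 0 i by rewrite mxE.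
  by rewrite colE aE mulmx_sumr summxE big1 // [RHS]mxE.
have := fg a; have := gu a; rewrite /frame_deriv /dirderiv => gu_a fg_a.
have [p0 p1 z0 z1 [m0 m1]] := ladder_frame p a.
rewrite /alpha !mulmxDl -!mulmxA; case: (ord2P B) => ->.
  rewrite p0 z0 m0 mulmx0 add0r -!scalemxAr.
  by move: (dform g p *m _) (dform u p *m _) gu_a => A C eqAC; rewrite !mxE eqAC; ring.
rewrite p1 z1 m1 mulmx0 addr0 -!scalemxAr.
by move: (dform f p *m _) (dform g p *m _) fg_a => A C eqAC; rewrite !mxE eqAC; ring.
Qed.

(** * The components of a Killing tensor *)

Section Components.
Context (j : nat) (mu : Htensor M (2 * j)) (mu_killing : killing_tensor spl mu).

Definition killing_coef (n : int) : R[i] :=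
  if `|n| <= j%:Z then (-1) ^ n * 'C(2 * j, `|(j%:Z + n)%R|%N)%:R else 0.

Lemma killing_componentE n :
  killing_component mu h n =
  fun p => killing_coef n * word_component mu `|(j%:Z + n)%R|%N p.
Proof.
apply/funext => p; rewrite /killing_component /killing_coef.
by case: ifP => _; rewrite ?mul0r.
Qed.

(** The binomial coefficient vanishes above the range of the chain, which makes
    the formula uniform in z. *)
Lemma killing_coef_nat (z : nat) :
  killing_coef (z%:Z - j%:Z) = (-1) ^ (z%:Z - j%:Z) * 'C(2 * j, z)%:R.
Proof.
rewrite /killing_coef [_ + (_ - _)]addrC subrK absz_nat; case: ifP => // z_big.
by rewrite bin_small ?mulr0 //; lia.
Qed.

Lemma frame_deriv_component n p a B :
  frame_deriv (killing_component mu h n) p a B =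
  killing_coef n * frame_deriv (word_component mu `|(j%:Z + n)%R|%N) p a B.
Proof.
rewrite killing_componentE /frame_deriv /dirderiv.
by rewrite (dform_scale _ openT (word_component_smooth mu_killing _) I) -scalemxAl mxE.
Qed.

(** With Z = j + n + 1, this is [killing_frame_relation] rescaled by the
    components' coefficients; Z = 0 and Z = 2j + 1 are the ends of the chain,
    beyond which both sides vanish. *)
Lemma killing_component_step n p a :
  frame_deriv (killing_component mu h n) p a 0 =
  frame_deriv (killing_component mu h (n + 1)) p a 1.
Proof.
rewrite !frame_deriv_component.
have [n_low|n_high] := ltP (j%:Z + n) 0.
  rewrite [killing_coef n]ifF ?mul0r; last lia.
  have [n1_low|n1] := ltP (j%:Z + (n + 1)) 0.
    by rewrite [killing_coef _]ifF ?mul0r; last lia.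
  have -> : (`|(j%:Z + (n + 1))%R| = 0)%N by lia.
  have /eqP := killing_frame_relation mu_killing p a (leq0n _).
  rewrite mul0r add0r mulf_eq0 pnatr_eq0 /= => /eqP->.
  by rewrite mulr0.
have [z zE] : exists z : nat, n = z%:Z - j%:Z by exists `|(j%:Z + n)%R|%N; lia.
have -> : n + 1 = z.+1%:Z - j%:Z by lia.
rewrite zE !killing_coef_nat.
have -> : (`|(j%:Z + (z%:Z - j%:Z))%R| = z)%N by lia.
have -> : (`|(j%:Z + (z.+1%:Z - j%:Z))%R| = z.+1)%N by lia.
have -> : z.+1%:Z - j%:Z = (z%:Z - j%:Z) + 1 by lia.
rewrite [(-1) ^ (_ + 1)]expfzDr ?oppr_eq0 ?oner_eq0 // expr1z mulrN1 !mulNr.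
rewrite -!mulrA -mulrN.
congr (_ * _).
have [z_big|z_small] := ltnP (2 * j) z.
  by rewrite !bin_small ?mul0r ?oppr0 //; lia.
have z1 : z.+1%:R != 0 :> R[i] by rewrite pnatr_eq0.
have rel := killing_frame_relation mu_killing p a (z_small : (z.+1 <= (2 * j).+1)%N).
move/eqP: rel; rewrite subSS addr_eq0 /= => /eqP rel.
apply: (mulfI z1); rewrite mulrCA rel !mulrN; congr (- _).
by rewrite [RHS]mulrA -natrM mul_bin_left natrM; ring.
Qed.
End Components.
End Killing.

Theorem proposition21 (R : realType) (m : nat) (m_gt0 : (0 < m)%N)
    (M : manifold R (4 * m)) (M_simply_connected : simply_connected R M)
    (hk : hyperkahler M) (spl : EH_splitting hk)
    (h : 'I_2 -> M -> 'cV[R[i]]_2) (h_frame : adapted_parallel_frame spl h)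
    (j : nat) (j_gt0 : (0 < j)%N)
    (mu : Htensor M (2 * j)) (mu_killing : killing_tensor spl mu) :
  recursive_chain hk setT (killing_component mu h) /\
  bounded_chain (killing_component mu h).
Proof.
split; last first.
  by exists j%:Z => n; rewrite ltNge /killing_component => /negPf->.
have [[x _] _ _] := M_simply_connected.
split; first exact: openT.
- by exists x.
- move=> n; rewrite killing_componentE.
  by apply: smooth_on_scale (word_component_smooth h_frame mu_killing _); exact: openT.
move=> n p _; apply: (chain_frame h_frame) => a.
  by rewrite (killing_component_step h_frame mu_killing) subrK.
exact: killing_component_step.
Qed.
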